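(* Let $F\colon\mathcal{W}\to\mathbb{R}^{m\times n}$ be smooth, let $G(W)=-\tfrac12\sum_{k=1}^m\mathrm{Var}_{W_k}(F_k(W))$, and consider the Lagrangian $L\colon T\mathcal{W}\to\mathbb{R}$, $L(W,V)=\tfrac12\|V\|_g^2-G(W)$. The Lagrangian vector field $X_E$ on $T\mathcal{W}$ associated to $L$ is given at every point $(W,V)\in T\mathcal{W}=\mathcal{W}\times\mathcal{T}_0$ by $$X_E(W,V)=\begin{pmatrix} V\\ \tfrac12\mathcal{A}(W,V)-\mathrm{grad}^g G(W)\end{pmatrix}\in\mathcal{T}_0\times\mathcal{T}_0 .$$
   Context: Let $m,n$ be positive integers, and write $A_i$ for the $i$-th row of a matrix $A$, regarded as a column vector. The assignment manifold is $\mathcal{W} = \{W\in\mathbb{R}^{m\times n} : W>0 \text{ entrywise},\ W\mathbf{1}_n=\mathbf{1}_m\}$. All its tangent spaces are identified with $\mathcal{T}_0=\{V\in\mathbb{R}^{m\times n}: V\mathbf{1}_n=0\}$, so $T\mathcal{W}=\mathcal{W}\times\mathcal{T}_0$ and $T_{(W,V)}T\mathcal{W}=\mathcal{T}_0\times\mathcal{T}_0$. It carries the Fisher-Rao metric $g_W(U,V)=\sum_{i,j} U_{ij}V_{ij}/W_{ij}$, with $\|V\|_g^2=g_W(V,V)$ and Riemannian gradient $\mathrm{grad}^g$. For a probability vector $p\in\mathbb{R}^n$ and $a\in\mathbb{R}^n$, $\mathrm{Var}_p(a)=\sum_j p^j (a^j)^2-\big(\sum_j p^ja^j\big)^2$.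 The map $\mathcal{A}\colon\mathcal{W}\times\mathcal{T}_0\to\mathcal{T}_0$ is defined row-wise by $(\mathcal{A}(W,V))_i=A(W_i,V_i)$, where $A(p,v)^j=\frac{(v^j)^2}{p^j}-\Big(\sum_{l=1}^n\frac{(v^l)^2}{p^l}\Big)p^j$. For a smooth function $L$ on $TM$, the fiber derivative $\mathbb{F}L\colon TM\to T^*M$ is $\mathbb{F}L(x,v)=(x,d(L|_{T_xM})|_v)$. The Lagrangian two-form is $\omega_L=(\mathbb{F}L)^*\omega^{\mathrm{can}}$, where $\omega^{\mathrm{can}}=\sum_i dq^i\wedge dp_i$ is the canonical symplectic form on $T^*M$. The energy is $E(x,v)=\mathbb{F}L(x,v)[v]-L(x,v)$; for the Lagrangian above, $E(W,V)=\tfrac12\|V\|_g^2+G(W)$. The Lagrangian vector field $X_E$ is the unique vector field on $TM$ with $dE[\,\cdot\,]=\omega_L(X_E,\cdot\,)$. *)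

(* Defs.v *)
From HB Require Import structures.
From mathcomp Require Import all_boot all_order all_algebra.
From mathcomp Require Import all_classical all_reals all_analysis.

Set Implicit Arguments.
Unset Strict Implicit.
Unset Printing Implicit Defensive.

Import Order.TTheory GRing.Theory Num.Theory.
Import numFieldNormedType.Exports.

Local Open Scope classical_set_scope.
Local Open Scope ring_scope.

(* C^oo maps on a set D that is relatively open in an affine space with
   direction T: all iterated directional derivatives along T exist and are
   continuous on D. Since x + h *: v stays in D for x in D, v in T and h small,
   this depends only on the restriction of f to D; the same remark applies to
   every directional derivative 'D_v taken below, so that maps on D are
   represented by total functions whose values outside D are irrelevant. *)
Definition smooth_on (R : realType) (X Y : normedModType R)
    (D T : set X) (f : X -> Y) : Prop :=
  forall vs : seq X, (forall v, v \in vs -> T v) ->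
    let df := foldr (fun v (g : X -> Y) => 'D_v g) f vs in
    (forall x v, D x -> T v -> derivable df x v) /\ {within D, continuous df}.

(* Throughout, the matrices have m.+1 rows and n.+1 columns. *)
Section AssignmentManifold.
Context (R : realType) (m n : nat).

Notation mat := 'M[R]_(m.+1, n.+1).

Definition assignment_manifold : set mat :=
  [set W : mat | (forall i j, 0 < W i j) /\
           W *m const_mx 1 = const_mx 1 :> 'cV[R]_m.+1].

Definition tangent_space : set mat :=
  [set V : mat | V *m const_mx 1 = 0 :> 'cV[R]_m.+1].

Definition tangent_bundle : set (mat * mat) :=
  assignment_manifold `*` tangent_space.

(* The common tangent space T_(W, V) TW of the tangent bundle. *)
Definition double_tangent_space : set (mat * mat) :=
  tangent_space `*` tangent_space.

Definition fisher_rao (W U V : mat) : R :=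
  \sum_i \sum_j U i j * V i j / W i j.

(* The gradient is determined by its defining property because the Fisher-Rao
   metric is nondegenerate on the tangent space. *)
Definition riemannian_gradient (G : mat -> R) (W : mat) : mat :=
  xget 0 [set X : mat | tangent_space X /\
    forall U, tangent_space U -> fisher_rao W X U = 'D_U G W].

Definition weighted_variance (p a : 'rV[R]_n.+1) : R :=
  \sum_j p 0 j * a 0 j ^+ 2 - (\sum_j p 0 j * a 0 j) ^+ 2.

Definition quadratic_row (p v : 'rV[R]_n.+1) : 'rV[R]_n.+1 :=
  \row_j (v 0 j ^+ 2 / p 0 j - (\sum_l v 0 l ^+ 2 / p 0 l) * p 0 j).

Definition quadratic_map (W V : mat) : mat :=
  \matrix_i quadratic_row (row i W) (row i V).

(* A covector is a linear form on the tangent space; only its values there are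
   meaningful. The cotangent bundle is assignment_manifold x covector, and its
   tangent spaces are tangent_space x covector. *)
Definition covector := mat -> R.

Definition fiber_derivative (L : mat * mat -> R) (x : mat * mat) :
    mat * covector :=
  (x.1, fun Z => 'D_Z (fun v => L (x.1, v)) x.2).

(* The differential at x, in the direction u, of a map into the cotangent
   bundle; a curve of covectors is differentiated pointwise, which is its
   derivative in the finite-dimensional dual of the tangent space. *)
Definition cotangent_differential (f : mat * mat -> mat * covector)
    (x u : mat * mat) : mat * covector :=
  ('D_u (fun y => (f y).1) x, fun Z => 'D_u (fun y => (f y).2 Z) x).

(* The entries W i j with j < n are global coordinates q on the assignment
   manifold, the last column being determined by the others; coord_vector i j
   is the coordinate vector field d/dq^(i,j), and the conjugate momentum of
   a covector is its value on this vector. *)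
Definition coord_vector (i : 'I_m.+1) (j : 'I_n) : mat :=
  delta_mx i (widen_ord (leqnSn n) j) - delta_mx i ord_max.

Definition dq (i : 'I_m.+1) (j : 'I_n) (xi : mat * covector) : R :=
  xi.1 i (widen_ord (leqnSn n) j).

Definition dp (i : 'I_m.+1) (j : 'I_n) (xi : mat * covector) : R :=
  xi.2 (coord_vector i j).

(* The sum of the dq /\ dp; it has constant coefficients in the coordinates
   (q, p), so the base point is omitted. *)
Definition canonical_form (xi eta : mat * covector) : R :=
  \sum_i \sum_j (dq i j xi * dp i j eta - dq i j eta * dp i j xi).

Definition lagrangian_form (L : mat * mat -> R) (x u w : mat * mat) : R :=
  canonical_form (cotangent_differential (fiber_derivative L) x u)
                 (cotangent_differential (fiber_derivative L) x w).

Definition energy (L : mat * mat -> R) (x : mat * mat) : R :=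
  (fiber_derivative L x).2 x.2 - L x.

Definition vector_field (X : mat * mat -> mat * mat) : Prop :=
  (forall x, tangent_bundle x -> double_tangent_space (X x)) /\
  smooth_on tangent_bundle double_tangent_space X.

Definition is_lagrangian_vector_field (L : mat * mat -> R)
    (X : mat * mat -> mat * mat) : Prop :=
  vector_field X /\
  forall x, tangent_bundle x -> forall u, double_tangent_space u ->
    'D_u (energy L) x = lagrangian_form L x (X x) u.

Definition potential (F : mat -> mat) (W : mat) : R :=
  - 2^-1 * \sum_k weighted_variance (row k W) (row k (F W)).

Definition lagrangian (F : mat -> mat) (x : mat * mat) : R :=
  2^-1 * fisher_rao x.1 x.2 x.2 - potential F x.1.

End AssignmentManifold.

Arguments assignment_manifold : clear implicits.
Arguments tangent_space : clear implicits.
Arguments tangent_bundle : clear implicits.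
Arguments double_tangent_space : clear implicits.

(* Main.v *)
(* For a point (W, V) and tangent vectors X = (X1, X2), u = (U1, U2), write
   s(P) for the sum of the V i j ^ 2 * P i j / W i j ^ 2. The variation of the
   metric contributes symmetric terms to omega_L, which cancel, so that
     omega_L(X, u) = g_W(U2, X1) - g_W(X2, U1),
   while dE(u) = g_W(V, U2) - s(U1) / 2 + dG(U1). Since s(U1) = g_W(A(W, V), U1)
   on the tangent space and g_W is nondegenerate there, dE = omega_L(X, .)
   amounts to X1 = V and X2 = A(W, V) / 2 - grad G(W).
   That the gradient exists requires dG to be linear along the tangent space,
   which is derived from the continuity of the directional derivatives. *)

Require Import Defs.
From HB Require Import structures.
From mathcomp Require Import all_boot all_order all_algebra.
From mathcomp Require Import all_classical all_reals all_analysis.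
From mathcomp Require Import ring.

Set Implicit Arguments.
Unset Strict Implicit.
Unset Printing Implicit Defensive.

Import Order.TTheory GRing.Theory Num.Theory.
Import numFieldNormedType.Exports.

Local Open Scope classical_set_scope.
Local Open Scope ring_scope.

(** * Smoothness relative to a set of directions *)

Lemma is_derive_linear {R : realType} {X Y : normedModType R}
    (f : {linear X -> Y}) (x v : X) :
  continuous f -> is_derive x v f (f v).
Proof.
move=> cf; have df := linear_differentiable x cf.
by split; [exact: diff_derivable | rewrite deriveE// diff_lin].
Qed.

Lemma is_derive_scalel {R : realType} {X Y : normedModType R}
    (f : X -> R) (c : Y) x v (d : R) :
  is_derive x v f d -> is_derive x v (fun y => f y *: c) (d *: c).
Proof.
move=> [fd <-].
have cg : (h^-1 *: (((fun y => f y *: c) \o shift x) (h *: v) - f x *: c))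
    @[h --> (0 : R)^'] --> 'D_v f x *: c.
  under eq_fun do rewrite -scalerBl scalerA.
  exact: cvgZr_tmp fd.
split; first by apply/cvg_ex; exists ('D_v f x *: c).
exact: cvg_lim cg.
Qed.

(** The difference quotient of [s |-> f (s *: u + x)] at [t * c] is literally that of f along u, so
    directional derivability suffices; the chain rule with [s |-> s * c] supplies the factor c. *)
Lemma is_derive_line {R : realType} {X : normedModType R}
    (f : X -> R) (x u : X) (c t d : R) :
  is_derive ((t * c) *: u + x) u f d ->
  is_derive t 1 (fun s : R => f ((s * c) *: u + x)) (d * c).
Proof.
move=> fd.
apply: (@is_derive1_comp _ (fun s : R => f (s *: u + x)) (fun s => s * c)).
  have E : (fun h : R => h^-1 *: (((fun s : R => f (s *: u + x)) \o shift (t * c))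
      (h *: 1) - f ((t * c) *: u + x)))
    = (fun h : R => h^-1 *: ((f \o shift ((t * c) *: u + x)) (h *: u)
      - f ((t * c) *: u + x))).
    apply/funext => h /=.
    by rewrite [h *: 1]mulr1 scalerDl addrA.
  by case: fd => fd <-; split; rewrite /derivable /derive E.
have := is_derive_scalel c (is_derive_id t (1 : R)).
by rewrite scale1r.
Qed.

Section LocalSmoothness.
Context {R : realType} {X : normedModType R} (D T : set X).

(* D is relatively open in an affine space with direction T. *)
Definition relatively_open : Prop :=
  (forall a u v, T u -> T v -> T (a *: u + v)) /\
  (forall x, D x -> \forall k \near (0 : X), T k -> D (k + x)).

Hypothesis openD : relatively_open.

Lemma near_line (x v : X) : D x -> T v -> \forall h \near (0 : R), D (h *: v + x).
Proof.
move=> Dx Tv; have [Tlin /(_ _ Dx) nD] := openD.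
have T0 : T 0 by have := Tlin (-1) v v Tv Tv; rewrite scaleN1r addNr.
have cv : (fun h : R => h *: v) @ (0 : R) --> (0 : X).
  by rewrite -[X in _ --> X](scale0r v); apply: cvgZr_tmp; exact: cvg_id.
have := cv _ nD; rewrite /= nbhs_simpl /=; apply: filterS => h /=; apply.
by rewrite -[h *: v]addr0; apply: Tlin.
Qed.

Lemma near_line_eq {Y : normedModType R} (f g : X -> Y) (x v : X) :
  {in D, f =1 g} -> D x -> T v ->
  {near (0 : R)^', (fun h => h^-1 *: ((f \o shift x) (h *: v) - f x)) =1
                   (fun h => h^-1 *: ((g \o shift x) (h *: v) - g x))}.
Proof.
move=> fg Dx Tv; apply: nbhs_dnbhs.
have := near_line Dx Tv; apply: filterS => h Dh /=.
by rewrite !fg ?inE.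
Qed.

(** A line through a point of D in a direction of T stays in D for small parameters, so the two
    difference quotients coincide near 0. *)
Lemma is_derive_eq_in {Y : normedModType R} (f g : X -> Y) (x v : X) (d : Y) :
  {in D, f =1 g} -> D x -> T v -> is_derive x v f d -> is_derive x v g d.
Proof.
move=> fg Dx Tv [fd <-].
have gf : {in D, g =1 f} by move=> y /fg.
have cg : (h^-1 *: ((g \o shift x) (h *: v) - g x)) @[h --> (0 : R)^'] --> 'D_v f x.
  by apply: cvg_trans (near_eq_cvg (near_line_eq fg Dx Tv)) _; exact: fd.
split; first by apply/cvg_ex; exists ('D_v f x).
exact: cvg_lim cg.
Qed.

Lemma within_continuous_eq_in {Y : normedModType R} (f g : X -> Y) :
  {in D, f =1 g} -> {within D, continuous f} -> {within D, continuous g}.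
Proof.
move=> fg /subspace_continuousP cf; apply/subspace_continuousP => x Dx.
have fgx : f x = g x by apply: fg; rewrite inE.
have := cf x Dx; rewrite [X in _ --> X]fgx; apply: cvg_trans.
apply: near_eq_cvg; rewrite near_withinE; near=> y => Dy.
by apply: fg; rewrite inE.
Unshelve. all: by end_near. Qed.

(** Serves as a coinduction principle: by induction on the list of directions, each iterated
    derivative agrees on D with a member of P, whose continuity and derivability then transfer. The
    closure properties below only have to exhibit a class stable under one differentiation. *)
Lemma smooth_on_coind {Y : normedModType R} (P : (X -> Y) -> Prop) :
  (forall f, P f -> {within D, continuous f} /\
    forall v, T v -> exists2 g, P g & forall x, D x -> is_derive x v f (g x)) ->
  forall f, P f -> smooth_on D T f.
Proof.
move=> Pstep f Pf vs Tvs /=.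
suff [g Pg fg] : exists2 g, P g &
    {in D, foldr (fun v (g : X -> Y) => 'D_v g) f vs =1 g}.
  have gf : {in D, g =1 foldr (fun v (g : X -> Y) => 'D_v g) f vs}.
    by move=> y /fg.
  have [cg dg] := Pstep _ Pg; split; last exact: within_continuous_eq_in cg.
  move=> x v Dx Tv; have [d _ dE] := dg v Tv.
  by have [] := is_derive_eq_in gf Dx Tv (dE x Dx).
elim: vs Tvs => [_|v vs IH Tvs /=]; first by exists f.
have [|g Pg fg] := IH; first by move=> w wvs; apply: Tvs; rewrite inE wvs orbT.
have gf : {in D, g =1 foldr (fun v (g : X -> Y) => 'D_v g) f vs}.
  by move=> y /fg.
have Tv : T v by apply: Tvs; rewrite inE eqxx.
have [_ /(_ v Tv) [d Pd dE]] := Pstep _ Pg; exists d => // x /set_mem Dx.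
by have [] := is_derive_eq_in gf Dx Tv (dE x Dx).
Qed.

Lemma smooth_on_derive {Y : normedModType R} (f : X -> Y) (v : X) :
  T v -> smooth_on D T f -> smooth_on D T ('D_v f).
Proof.
(* [foldr] applies the last direction of the list first, so appending v makes ['D_v] act on f before
   the others. *)
move=> Tv sf vs Tvs; have := sf (rcons vs v); rewrite foldr_rcons; apply.
by move=> w; rewrite mem_rcons inE => /predU1P[->|/Tvs].
Qed.

Lemma smooth_on_is_derive {Y : normedModType R} (f : X -> Y) (x v : X) :
  smooth_on D T f -> D x -> T v -> is_derive x v f ('D_v f x).
Proof.
move=> /(_ [::]) [//|/= df _] Dx Tv; split=> //; exact: df.
Qed.

Lemma smooth_on_continuous {Y : normedModType R} (f : X -> Y) :
  smooth_on D T f -> {within D, continuous f}.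
Proof. by move=> /(_ [::]) []. Qed.

Lemma smooth_on_eq_in {Y : normedModType R} (f g : X -> Y) :
  {in D, f =1 g} -> smooth_on D T f -> smooth_on D T g.
Proof.
move=> fg sf.
apply: (smooth_on_coind (P := fun g => exists2 f, smooth_on D T f & {in D, f =1 g})).
  move=> {fg sf g}f [g sg gf]; split.
    exact: within_continuous_eq_in gf (smooth_on_continuous sg).
  move=> v Tv; exists ('D_v g).
    by exists ('D_v g) => //; exact: smooth_on_derive.
  move=> x Dx; have := smooth_on_is_derive sg Dx Tv; exact: is_derive_eq_in.
by exists f.
Qed.

(** * Closure of smooth maps under algebraic operations *)

Lemma smooth_on_cst {Y : normedModType R} (c : Y) : smooth_on D T (cst c).
Proof.
apply: (smooth_on_coind (P := fun f => exists c, f = cst c)); last by exists c.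
move=> _ [{}c ->]; split; first by move=> x; exact: cvg_cst.
by move=> v _; exists (cst 0); [exists 0 | move=> x _; exact: is_derive_cst].
Qed.

(** Directional derivatives of a linear map are constant, so the map together with the constants is
    a stable class. *)
Lemma smooth_on_linear {Y : normedModType R} (f : {linear X -> Y}) :
  continuous f -> smooth_on D T f.
Proof.
move=> cf; apply: (smooth_on_coind
  (P := fun g => (exists c, g = cst c) \/ g = f)); last by right.
move=> _ [[c ->]|->]; split.
- by move=> x; exact: cvg_cst.
- by move=> v _; exists (cst 0); [left; exists 0 | move=> x _; exact: is_derive_cst].
- exact: continuous_subspaceT.
move=> v _; exists (cst (f v)); first by left; exists (f v).
by move=> x _; exact: is_derive_linear.
Qed.

Lemma smooth_onD {Y : normedModType R} (f g : X -> Y) :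
  smooth_on D T f -> smooth_on D T g ->
  smooth_on D T (fun x => f x + g x).
Proof.
move=> sf sg; apply: (smooth_on_coind (P := fun h => exists f g,
  [/\ smooth_on D T f, smooth_on D T g & h = f \+ g])); last by exists f, g.
move=> _ [{sf}f [{sg}g [sf sg ->]]]; split.
  by move=> x; apply: cvgD;
    [exact: smooth_on_continuous sf x|exact: smooth_on_continuous sg x].
move=> v Tv; exists ('D_v f \+ 'D_v g).
  by exists ('D_v f), ('D_v g); split=> //; exact: smooth_on_derive.
by move=> x Dx; apply: is_deriveD; exact: smooth_on_is_derive.
Qed.

Lemma smooth_on_sum {Y : normedModType R} (I : finType) (f : I -> X -> Y) :
  (forall i, smooth_on D T (f i)) -> smooth_on D T (fun x => \sum_i f i x).
Proof.
move=> sf; elim: (index_enum I) => [|i s IH].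
  apply: smooth_on_eq_in (smooth_on_cst 0) => x _; by rewrite big_nil.
apply: smooth_on_eq_in (smooth_onD (sf i) IH) => x _; by rewrite big_cons.
Qed.

Lemma smooth_on_scalel {Y : normedModType R} (f : X -> R) (c : Y) :
  smooth_on D T f -> smooth_on D T (fun x => f x *: c).
Proof.
move=> sf; apply: (smooth_on_coind (P := fun h => exists2 f : X -> R,
  smooth_on D T f & h = (fun x => f x *: c))); last by exists f.
move=> _ [{sf}f sf ->]; split.
  by move=> x; apply: cvgZr_tmp; exact: smooth_on_continuous sf x.
move=> v Tv; exists (fun x => 'D_v f x *: c).
  by exists ('D_v f) => //; exact: smooth_on_derive.
by move=> x Dx; apply: is_derive_scalel; exact: smooth_on_is_derive.
Qed.

(* Unlike the products and inverses themselves, this algebra is stable under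
   differentiation on D. *)
Inductive smooth_algebra : (X -> R) -> Prop :=
| smooth_algebra_base f : smooth_on D T f -> smooth_algebra f
| smooth_algebraD f g :
    smooth_algebra f -> smooth_algebra g -> smooth_algebra (f \+ g)
| smooth_algebraM f g :
    smooth_algebra f -> smooth_algebra g -> smooth_algebra (f \* g)
| smooth_algebraV f : (forall x, D x -> f x != 0) ->
    smooth_algebra f -> smooth_algebra (fun x => (f x)^-1).

(** Structural induction gives, for each member, continuity on D and derivatives that are again
    members; the coinduction principle concludes. *)
Lemma smooth_on_algebra f : smooth_algebra f -> smooth_on D T f.
Proof.
apply: smooth_on_coind => {}f; elim=> {f}.
- move=> f sf; split; first exact: smooth_on_continuous.
  move=> v Tv; exists ('D_v f).
    exact: smooth_algebra_base (smooth_on_derive Tv sf).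
  by move=> x Dx; exact: smooth_on_is_derive.
- move=> f g _ [cf df] _ [cg dg]; split.
    by move=> x; apply: cvgD; [exact: cf|exact: cg].
  move=> v Tv; have [f' sf' Ef] := df v Tv; have [g' sg' Eg] := dg v Tv.
  exists (f' \+ g'); first exact: smooth_algebraD.
  by move=> x Dx; apply: is_deriveD; [exact: Ef|exact: Eg].
- move=> f g sf [cf df] sg [cg dg]; split.
    by move=> x; apply: cvgM; [exact: cf|exact: cg].
  move=> v Tv; have [f' sf' Ef] := df v Tv; have [g' sg' Eg] := dg v Tv.
  exists ((f \* g') \+ (g \* f')).
    by apply: smooth_algebraD; exact: smooth_algebraM.
  by move=> x Dx; apply: is_deriveM; [exact: Ef|exact: Eg].
move=> f f0 sf [/subspace_continuousP cf df]; split.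
  by apply/subspace_continuousP => x Dx; apply: cvgV; [exact: f0|exact: cf].
move=> v Tv; have [f' sf' Ef] := df v Tv.
have sV := smooth_algebraV f0 sf.
(* This is - f' / f ^ 2, written with products of members of the algebra only. *)
exists ((cst (-1) \* ((fun x => (f x)^-1) \* (fun x => (f x)^-1))) \* f').
  apply: smooth_algebraM => //; apply: smooth_algebraM; last exact: smooth_algebraM.
  by apply: smooth_algebra_base; exact: smooth_on_cst.
move=> x Dx; have [fd fE] := Ef x Dx; have fx0 := f0 x Dx.
split; first exact: derivableV.
by rewrite deriveV// fE /GRing.scale /= expr2 mulN1r invfM.
Qed.

Lemma smooth_onM (f g : X -> R) :
  smooth_on D T f -> smooth_on D T g ->
  smooth_on D T (fun x => f x * g x).
Proof.
by move=> sf sg; apply/smooth_on_algebra/smooth_algebraM; exact: smooth_algebra_base.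
Qed.

Lemma smooth_onMl (c : R) (f : X -> R) :
  smooth_on D T f -> smooth_on D T (fun x => c * f x).
Proof. by move=> sf; apply: (@smooth_onM (cst c) f) => //; exact: smooth_on_cst. Qed.

Lemma smooth_onB (f g : X -> R) :
  smooth_on D T f -> smooth_on D T g -> smooth_on D T (fun x => f x - g x).
Proof.
move=> sf sg; apply: smooth_on_eq_in (smooth_onD sf (smooth_onMl (- 1) sg)).
by move=> x _; rewrite mulN1r.
Qed.

Lemma smooth_onV (f : X -> R) : (forall x, D x -> f x != 0) ->
  smooth_on D T f -> smooth_on D T (fun x => (f x)^-1).
Proof.
move=> f0 sf; apply/smooth_on_algebra/smooth_algebraV => //.
exact: smooth_algebra_base.
Qed.

Lemma smooth_on_entry p q (f : X -> 'M[R]_(p.+1, q.+1)) i j :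
  smooth_on D T f -> smooth_on D T (fun x => f x i j).
Proof.
move=> sf; apply: (smooth_on_coind (P := fun h => exists2 f : X -> 'M[R]_(p.+1, q.+1),
  smooth_on D T f & h = (fun x => f x i j))); last by exists f.
move=> _ [{sf}f sf ->]; split.
  move=> x; apply: (@cvg_comp _ _ _ f (fun M : 'M[R]_(p.+1, q.+1) => M i j)).
    exact: smooth_on_continuous sf x.
  exact: coord_continuous.
move=> v Tv; exists (fun x => 'D_v f x i j).
  by exists ('D_v f) => //; exact: smooth_on_derive.
move=> x Dx; have [df _] := smooth_on_is_derive sf Dx Tv.
split; first by move/derivable_mxP : df.
by rewrite derive_mx// mxE.
Qed.

(* By the mean value theorem the increment in the direction [a *: u] is a
   derivative along u at a nearby point of D; continuity of ['D_u f] on D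
   concludes. *)
Lemma smooth_on_derive_linear (f : X -> R) (x u v : X) (a : R) :
  smooth_on D T f -> D x -> T u -> T v ->
  'D_(a *: u + v) f x = a * 'D_u f x + 'D_v f x.
Proof.
move=> sf Dx Tu Tv; have [Tlin nD] := openD.
have T0 : T 0 by have := Tlin (-1) v v Tv Tv; rewrite scaleN1r addNr.
have Tsc c w : T w -> T (c *: w).
  by move=> Tw; rewrite -[_ *: _]addr0; exact: Tlin.
apply: cvg_lim => //.
(* The increment is split at the intermediate point [h *: v + x]: the second part is the quotient
   along v, the first is a move along u from a varying base point. *)
have -> : (fun h : R => h^-1 *: ((f \o shift x) (h *: (a *: u + v)) - f x)) =
    (fun h => h^-1 *: (f ((h * a) *: u + (h *: v + x)) - f (h *: v + x)))
    \+ (fun h => h^-1 *: ((f \o shift x) (h *: v) - f x)).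
  apply/funext => h /=.
  rewrite -[RHS]scalerDr [X in _ = _ *: X]addrA subrK.
  by rewrite [h *: (_ + _)]scalerDr scalerA addrA.
apply: cvgD; last by have [] := smooth_on_is_derive sf Dx Tv.
apply/cvgrPdist_lt => e e0.
have /subspace_continuousP/(_ x Dx) :=
  smooth_on_continuous (smooth_on_derive Tu sf).
move=> /(cvgZl_tmp (k := a)) /cvgrPdist_lt/(_ e e0).
rewrite near_withinE => ncD.
have : \forall y \near x, D y -> `|a * 'D_u f x - a * 'D_u f y| < e := ncD.
rewrite (near_shift 0) subr0 => cD.
have /nbhs_ballP[d /= d0 bd] : \forall k \near (0 : X), T k ->
    D (k + x) /\ `|a * 'D_u f x - a * 'D_u f (k + x)| < e.
  have := nD _ Dx; apply: filterS2 cD => k /= + /[swap] Tk /(_ Tk) Dk.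
  by move=> /(_ Dk).
have Dk k : T k -> `|k| < d ->
    D (k + x) /\ `|a * 'D_u f x - a * 'D_u f (k + x)| < e.
  by move=> Tk kd; apply: bd => //; rewrite -ball_normE /= sub0r normrN.
(* C is chosen so that the segment [y t], for t in [0, 1], has norm at most [|h| * C]; the summand 1
   keeps C positive when u and v vanish. *)
pose C := `|v| + `|a| * `|u| + 1.
have C0 : 0 < C by rewrite ltr_wpDl// addr_ge0// mulr_ge0.
near=> h.
have h0 : h != 0 by near: h; exact: nbhs_dnbhs_neq.
have hd : `|h| < d / C.
  by near: h; apply: dnbhs0_lt; rewrite divr_gt0.
pose y (t : R) := (t * (h * a)) *: u + h *: v.
have Ty t : T (y t) by apply: (Tlin _ _ _ Tu); exact: Tsc.
have yd (t : R) : t \in `[0, 1] -> `|y t| < d.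
  rewrite in_itv /= => /andP[t0 t1].
  apply: (@le_lt_trans _ _ (`|h| * C)); last by rewrite -ltr_pdivlMr.
  apply: (le_trans (ler_normD _ _)); rewrite !normrZ -mulrA /C !mulrDr mulr1.
  rewrite [`|h| * (`|a| * `|u|)]mulrA addrC -addrA lerD2l ler_wpDr//.
  by rewrite -[leRHS]mul1r ler_wpM2r ?mulr_ge0// ger0_norm.
(* phi runs along the segment whose end values differ by the numerator of the first quotient; the
   factor [h * a] in its derivative later cancels [h^-1]. *)
pose phi (t : R) := f ((t * (h * a)) *: u + (h *: v + x)).
have dphi (t : R) : t \in `[0, 1] -> is_derive t 1 phi ('D_u f (y t + x) * (h * a)).
  move=> t01; apply: is_derive_line; rewrite addrA.
  by apply: smooth_on_is_derive => //; have [] := Dk _ (Ty t) (yd _ t01).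
have dphi' (t : R) : t \in `]0, 1[ -> is_derive t 1 phi ('D_u f (y t + x) * (h * a)).
  by move=> t01; apply: dphi; exact: subset_itv_oo_cc.
have cphi : {within `[0, 1], continuous phi}.
  by apply: derivable_within_continuous => t t01; have [] := dphi _ t01.
have [c c01] := MVT_segment ler01 dphi' cphi.
rewrite /phi !mul0r scale0r add0r mul1r subr0 mulr1 => ->.
have [_] := Dk _ (Ty c) (yd _ c01).
suff -> : h^-1 *: ('D_u f (y c + x) * (h * a)) = a * 'D_u f (y c + x) by [].
by rewrite [LHS]mulrCA mulKf// mulrC.
Unshelve. all: by end_near. Qed.

End LocalSmoothness.

(** * Derivatives of sums, entries and composites with linear maps *)

Lemma is_derive_big {R : realType} {X Y : normedModType R} (I : finType)
    (f : I -> X -> Y) (df : I -> Y) (x v : X) :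
  (forall i, is_derive x v (f i) (df i)) ->
  is_derive x v (fun y => \sum_i f i y) (\sum_i df i).
Proof.
move=> fE; elim: (index_enum I) => [|i s IH].
  under eq_fun do rewrite big_nil; rewrite big_nil; exact: is_derive_cst.
under eq_fun do rewrite big_cons; rewrite big_cons.
exact: is_deriveD.
Qed.

Lemma is_derive_entry {R : realType} {X : normedModType R} p q
    (f : X -> 'M[R]_(p.+1, q.+1)) (df : 'M[R]_(p.+1, q.+1)) (x v : X) i j :
  is_derive x v f df -> is_derive x v (fun y => f y i j) (df i j).
Proof.
move=> [fd <-]; split; first by move/derivable_mxP : fd.
by rewrite derive_mx// mxE.
Qed.

(** Linearity makes the quotients equal for every h, so the derivative of a composite is computed
    without any regularity of g. *)
Lemma growth_rate_comp_linear {R : realType} {X Y Z : normedModType R}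
    (f : {linear X -> Y}) (g : Y -> Z) (x v : X) :
  (fun h : R => h^-1 *: ((g \o f \o shift x) (h *: v) - (g \o f) x)) =
  (fun h : R => h^-1 *: ((g \o shift (f x)) (h *: f v) - g (f x))).
Proof. by apply/funext => h /=; rewrite linearP. Qed.

Lemma derive_comp_linear {R : realType} {X Y Z : normedModType R}
    (f : {linear X -> Y}) (g : Y -> Z) (v : X) :
  'D_v (g \o f) = 'D_(f v) g \o f.
Proof. by apply/funext => x; rewrite /derive growth_rate_comp_linear. Qed.

Lemma derivable_comp_linear {R : realType} {X Y Z : normedModType R}
    (f : {linear X -> Y}) (g : Y -> Z) (x v : X) :
  derivable g (f x) (f v) -> derivable (g \o f) x v.
Proof. by rewrite /derivable growth_rate_comp_linear. Qed.

(** Iterated derivatives of the composite along vs are those of g along the image directions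
    [map f vs], precomposed with f. *)
Lemma smooth_on_comp_linear {R : realType} {X Y Z : normedModType R}
    (D T : set X) (D' T' : set Y) (f : {linear X -> Y}) (g : Y -> Z) :
  continuous f -> (forall x, D x -> D' (f x)) -> (forall v, T v -> T' (f v)) ->
  smooth_on D' T' g -> smooth_on D T (g \o f).
Proof.
move=> cf fD fT sg vs Tvs /=.
have -> : foldr (fun v (g : X -> Z) => 'D_v g) (g \o f) vs =
    foldr (fun v (g : Y -> Z) => 'D_v g) g (map f vs) \o f.
  by elim: vs {Tvs} => //= v vs ->; rewrite derive_comp_linear.
have [|dg /subspace_continuousP cg] := sg (map f vs).
  by move=> _ /mapP[v /Tvs Tv ->]; exact: fT.
split=> [x v Dx Tv|].
  exact: derivable_comp_linear (dg _ _ (fD _ Dx) (fT _ Tv)).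
apply/subspace_continuousP => x Dx.
apply: (@cvg_comp _ _ _ f _ _ (within D' (nbhs (f x)))); last exact: cg (fD _ Dx).
move=> P nP.
have nfP : \forall y \near x, D' (f y) -> P (f y) := cf x _ nP.
suff : \forall y \near x, D y -> P (f y) by [].
by apply: filterS nfP => y Py Dy; apply: Py; exact: fD.
Qed.

(** * The Fisher-Rao metric on the assignment manifold *)

Section AssignmentManifold.
Context {R : realType} {m n : nat}.

Notation mat := 'M[R]_(m.+1, n.+1).
Notation manifold := (assignment_manifold R m n).
Notation T0 := (tangent_space R m n).
Notation TW := (tangent_bundle R m n).
Notation TTW := (double_tangent_space R m n).

(** * Openness of the manifold and linear forms on its tangent space *)

Lemma mulmx_const1 (M : mat) i : (M *m (const_mx 1 : 'cV[R]_n.+1)) i 0 = \sum_j M i j.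
Proof. by rewrite mxE; apply: eq_bigr => j _; rewrite mxE mulr1. Qed.

Lemma tangent_spaceP (V : mat) : T0 V <-> forall i, \sum_j V i j = 0.
Proof.
split=> [V0 i|V0]; first by rewrite -mulmx_const1 V0 mxE.
by apply/matrixP => i j; rewrite (ord1 j) mulmx_const1 V0 mxE.
Qed.

Lemma assignment_manifoldP (W : mat) :
  manifold W <-> (forall i j, 0 < W i j) /\ forall i, \sum_j W i j = 1.
Proof.
split=> [[W0 W1]|[W0 W1]]; split=> //.
  by move=> i; rewrite -mulmx_const1 W1 mxE.
by apply/matrixP => i j; rewrite (ord1 j) mulmx_const1 W1 mxE.
Qed.

Lemma tangent_space_linear (a : R) (U V : mat) : T0 U -> T0 V -> T0 (a *: U + V).
Proof.
move=> U0 V0; rewrite /tangent_space /= mulmxDl -scalemxAl.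
by rewrite (U0 : U *m _ = 0) (V0 : V *m _ = 0) scaler0 addr0.
Qed.

Lemma tangent_space0 : T0 0.
Proof. by rewrite /tangent_space /= mul0mx. Qed.

(** Positivity of finitely many entries survives small perturbations, and tangent translations leave
    the row sums unchanged. *)
Lemma relatively_open_manifold : relatively_open manifold T0.
Proof.
split=> [|W WM]; first exact: tangent_space_linear.
have [W0 W1] := (assignment_manifoldP W).1 WM.
have nij i j : \forall K \near nbhs (0 : mat), 0 < (K + W) i j.
  have cij := @coord_continuous R m.+1 n.+1 i j (0 : mat).
  near=> K; rewrite mxE.
  have : `|(0 : mat) i j - K i j| < W i j.
    by near: K; move/cvgrPdist_lt : cij; apply; exact: W0.
  rewrite mxE sub0r normrN => /ltr_normlP[+ _].
  by rewrite -subr_gt0 opprK addrC.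
have ni i := @filter_forall _ _ (fun j (K : mat) => 0 < (K + W) i j)
  _ (nbhs_filter (0 : mat)) (nij i).
have nW := @filter_forall _ _ (fun i (K : mat) => forall j, 0 < (K + W) i j)
  _ (nbhs_filter (0 : mat)) ni.
near=> K => /tangent_spaceP K0; apply/assignment_manifoldP; split.
  by near: K.
move=> i; under eq_bigr do rewrite mxE.
by rewrite big_split /= K0 W1 add0r.
Unshelve. all: by end_near. Qed.

Lemma relatively_open_bundle : relatively_open TW TTW.
Proof.
have [lT oM] := relatively_open_manifold; split.
  by move=> a [u1 u2] [v1 v2] [/= ? ?] [/= ? ?]; split=> /=; exact: lT.
move=> [W V] [/= WM V0].
have nK : \forall K \near (0 : mat * mat), T0 K.1 -> manifold (K.1 + W).
  exact: (@cvg_fst _ _ (nbhs (0 : mat)) _ (nbhs_filter (0 : mat)) _ (oM W WM)).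
near=> K => -[K1 K2]; split; first by apply: (near nK K).
by rewrite /= -[K.2]scale1r; exact: lT.
Unshelve. all: by end_near. Qed.

(* Here j ranges over all columns, with [edge_vector i ord_max = 0], so that a
   tangent vector U is the sum of the [U i j *: edge_vector i j]. *)
Definition edge_vector (i : 'I_m.+1) (j : 'I_n.+1) : mat :=
  delta_mx i j - delta_mx i ord_max.

(** Covectors are bare functions whose values off the tangent space are arbitrary, so linearity is
    asked for on [T0] alone. *)
Definition tangent_linear (phi : mat -> R) : Prop :=
  forall a U V, T0 U -> T0 V -> phi (a *: U + V) = a * phi U + phi V.

Lemma tangent_linear0 phi : tangent_linear phi -> phi 0 = 0.
Proof.
move=> /(_ (-1) 0 0 tangent_space0 tangent_space0).
by rewrite scaler0 addr0 mulN1r addNr.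
Qed.

Lemma tangent_space_edge i j : T0 (edge_vector i j).
Proof.
have sumE k l : \sum_j (delta_mx i l : mat) k j = (k == i)%:R.
  rewrite (bigD1 l)//= mxE eqxx andbT big1 ?addr0// => p /negbTE pl.
  by rewrite mxE pl andbF.
apply/tangent_spaceP => k; rewrite /edge_vector.
transitivity (\sum_p (delta_mx i j : mat) k p - \sum_p (delta_mx i ord_max : mat) k p).
  by rewrite -sumrB; apply: eq_bigr => p _; rewrite [in LHS]mxE [in X in _ + X]mxE.
by rewrite !sumE subrr.
Qed.

Lemma tangent_linear_sum phi U : tangent_linear phi -> T0 U ->
  phi U = \sum_i \sum_j U i j * phi (edge_vector i j).
Proof.
move=> phiL U0.
have -> : phi U = phi (\sum_i \sum_j U i j *: edge_vector i j).
  congr phi; rewrite [LHS]matrix_sum_delta; apply: eq_bigr => i _.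
  under [RHS]eq_bigr do rewrite scalerBr.
  (* The last-column terms add up to a row sum of U, which vanishes. *)
  by rewrite sumrB -scaler_suml ((tangent_spaceP U).1 U0) scale0r subr0.
rewrite !pair_bigA /=.
(* Membership of the partial sums in [T0] is carried along the induction, because phi is linear only
   there. *)
suff : T0 (\sum_(p : 'I_m.+1 * 'I_n.+1) U p.1 p.2 *: edge_vector p.1 p.2) /\
    phi (\sum_(p : 'I_m.+1 * 'I_n.+1) U p.1 p.2 *: edge_vector p.1 p.2) =
    \sum_(p : 'I_m.+1 * 'I_n.+1) U p.1 p.2 * phi (edge_vector p.1 p.2) by case.
elim: (index_enum _) => [|p s [Ts IH]].
  by rewrite !big_nil; split; [exact: tangent_space0|exact: tangent_linear0].
rewrite !big_cons -IH; split.
  by apply: tangent_space_linear => //; exact: tangent_space_edge.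
by apply: phiL => //; exact: tangent_space_edge.
Qed.

(** The coordinate vectors form a basis of the tangent space dual to the dq, so each sum of dq-
    times dp-components collapses to a covector evaluated on a tangent vector. *)
Lemma canonical_formE (xi eta : mat * covector R m n) :
  T0 xi.1 -> T0 eta.1 -> tangent_linear xi.2 -> tangent_linear eta.2 ->
  canonical_form xi eta = eta.2 xi.1 - xi.2 eta.1.
Proof.
move=> xi0 eta0 xiL etaL.
have coordE (phi : mat -> R) U : tangent_linear phi -> T0 U ->
    phi U = \sum_i \sum_j U i (widen_ord (leqnSn n) j) * phi (coord_vector R i j).
  move=> phiL U0; rewrite (tangent_linear_sum phiL U0); apply: eq_bigr => i _.
  (* The last column contributes phi of a zero edge vector; the other edge vectors are the
     coordinate vectors. *)
  rewrite big_ord_recr /= {2}/edge_vector subrr (tangent_linear0 phiL).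
  by rewrite mulr0 addr0.
rewrite /canonical_form (coordE _ _ etaL xi0) (coordE _ _ xiL eta0) -sumrB.
by apply: eq_bigr => i _; rewrite -sumrB.
Qed.

(** * Bilinearity, nondegeneracy and variation of the metric *)

Lemma fisher_raoC (W U V : mat) : fisher_rao W U V = fisher_rao W V U.
Proof. by apply: eq_bigr => i _; apply: eq_bigr => j _; rewrite [U i j * _]mulrC. Qed.

Lemma fisher_raoP (a : R) (W U U' V : mat) :
  fisher_rao W (a *: U + U') V = a * fisher_rao W U V + fisher_rao W U' V.
Proof.
rewrite /fisher_rao mulr_sumr -big_split; apply: eq_bigr => i _ /=.
rewrite mulr_sumr -big_split; apply: eq_bigr => j _ /=.
by rewrite !mxE !mulrDl !mulrA.
Qed.

(* The contribution to the differential of fisher_rao W U V of a variation of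
   W in the direction P, up to sign. *)
Definition fisher_rao_variation (W P U V : mat) : R :=
  \sum_i \sum_j U i j * V i j * P i j / W i j ^+ 2.

Lemma fisher_rao_variationP (a : R) (W P U V V' : mat) :
  fisher_rao_variation W P U (a *: V + V') =
  a * fisher_rao_variation W P U V + fisher_rao_variation W P U V'.
Proof.
rewrite /fisher_rao_variation mulr_sumr -big_split; apply: eq_bigr => i _ /=.
rewrite mulr_sumr -big_split; apply: eq_bigr => j _ /=.
by rewrite !mxE mulrDr !mulrDl [U i j * (a * _)]mulrCA !mulrA.
Qed.

Lemma fisher_rao_variationC (W P U V : mat) :
  fisher_rao_variation W P U V = fisher_rao_variation W V U P.
Proof. by apply: eq_bigr => i _; apply: eq_bigr => j _; rewrite [_ * P i j]mulrAC. Qed.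

(** Testing against X - Y itself yields a vanishing sum of nonnegative terms with positive
    weights. *)
Lemma fisher_rao_inj (W X Y : mat) : manifold W -> T0 X -> T0 Y ->
  (forall U, T0 U -> fisher_rao W X U = fisher_rao W Y U) -> X = Y.
Proof.
move=> /assignment_manifoldP[W0 _] X0 Y0 XY.
have Z0 : T0 (X - Y) by rewrite addrC -scaleN1r; exact: tangent_space_linear.
have : fisher_rao W (X - Y) (X - Y) = 0.
  by rewrite addrC -scaleN1r fisher_raoP scaleN1r addrC XY// mulN1r addNr.
have sq_ge0 i j : 0 <= (X - Y) i j * (X - Y) i j / W i j.
  by apply: divr_ge0; [rewrite -expr2 sqr_ge0|exact: ltW].
move=> /eqP; rewrite psumr_eq0 => [/allP XY0|i _]; last by rewrite sumr_ge0.
apply/matrixP => i j; apply/eqP; rewrite -subr_eq0.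
have := XY0 i (mem_index_enum _); rewrite implyTb psumr_eq0// => /allP.
move=> /(_ j (mem_index_enum _)) /=.
by rewrite !mulf_eq0 invr_eq0 (gt_eqF (W0 i j)) orbF orbb !mxE.
Qed.

(** Product rule with all three arguments moving; the fiber derivative, its differential and dE are
    obtained by specialising it. *)
Lemma is_derive_fisher_rao {X : normedModType R} (W U V : X -> mat) (x v : X)
    (dW dU dV : mat) :
  (forall i j, W x i j != 0) ->
  is_derive x v W dW -> is_derive x v U dU -> is_derive x v V dV ->
  is_derive x v (fun y => fisher_rao (W y) (U y) (V y))
    (fisher_rao (W x) dU (V x) + fisher_rao (W x) (U x) dV
     - fisher_rao_variation (W x) dW (U x) (V x)).
Proof.
move=> W0 WE UE VE.
rewrite /fisher_rao /fisher_rao_variation -big_split -sumrB /=.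
apply: is_derive_big => i; rewrite -big_split -sumrB /=.
apply: is_derive_big => j.
have Wij := is_derive_entry i j WE.
have WVij : is_derive x v (fun y => (W y i j)^-1) (- (W x i j) ^- 2 *: dW i j).
  have [Wd Wv] := Wij; split; first exact: derivableV.
  by rewrite deriveV// Wv.
apply: (is_derive_eq (is_deriveM (is_deriveM (is_derive_entry i j UE)
  (is_derive_entry i j VE)) WVij)).
rewrite /GRing.scale /= -exprVn; move: (W x i j)^-1 => w.
have E (a b c d e : R) : a * b * (- w ^+ 2 * c) + w * (a * e + b * d) =
    d * b * w + a * e * w - a * b * c * w ^+ 2 by ring.
exact: E.
Qed.

(** * The quadratic map and the Riemannian gradient *)

Lemma tangent_space_quadratic_map (W V : mat) : manifold W -> T0 (quadratic_map W V).
Proof.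
move=> /assignment_manifoldP[_ W1]; apply/tangent_spaceP => i.
under eq_bigr do rewrite !mxE.
rewrite sumrB -mulr_sumr.
rewrite W1 mulr1; apply/eqP; rewrite subr_eq0; apply/eqP.
by apply: eq_bigr => j _; rewrite !mxE.
Qed.

(** Division by [W i j] turns the correction term of the quadratic map into a row constant c times
    [U i j], which sums to zero along the row. *)
Lemma fisher_rao_quadratic_map (W V U : mat) : manifold W -> T0 U ->
  fisher_rao W (quadratic_map W V) U = fisher_rao_variation W U V V.
Proof.
move=> /assignment_manifoldP[W0 _] /tangent_spaceP U0; apply: eq_bigr => i _.
under eq_bigr do rewrite !mxE mulrBl mulrBl.
rewrite sumrB [X in _ - X](_ : _ = 0) ?subr0.
  by apply: eq_bigr => j _; rewrite !expr2 invfM !mulrA [V i j * V i j / _ * _]mulrAC.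
pose c := \sum_l row i V 0 l ^+ 2 / row i W 0 l.
transitivity (c * \sum_j U i j); last by rewrite U0 mulr0.
rewrite mulr_sumr; apply: eq_bigr => j _.
by rewrite mulrAC mulfK// lt0r_neq0.
Qed.

(** Row i is the replicator operator Diag(p) - p p^T, with p the i-th row of W, applied to
    derivatives of G. Edge vectors replace the Euclidean partials to keep to tangent directions; for
    a smooth extension of G this shifts a row by a constant, which the operator kills. *)
Definition explicit_gradient (G : mat -> R) (W : mat) : mat :=
  \matrix_(i, j) (W i j * ('D_(edge_vector i j) G W
                           - \sum_l W i l * 'D_(edge_vector i l) G W)).

Lemma tangent_space_explicit_gradient G W : manifold W -> T0 (explicit_gradient G W).
Proof.
move=> /assignment_manifoldP[_ W1]; apply/tangent_spaceP => i.
under eq_bigr do rewrite mxE mulrBr.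
by rewrite sumrB -mulr_suml W1 mul1r subrr.
Qed.

(** The metric cancels the factor [W i j], the mean c pairs to zero with the rows of U, and the rest
    is the edge-vector expansion of the differential of G. *)
Lemma fisher_rao_explicit_gradient G W U :
  smooth_on manifold T0 G -> manifold W -> T0 U ->
  fisher_rao W (explicit_gradient G W) U = 'D_U G W.
Proof.
move=> sG WM U0; have [W0 _] := (assignment_manifoldP W).1 WM.
have GL : tangent_linear (fun U => 'D_U G W).
  by move=> a X Y X0 Y0; exact: (smooth_on_derive_linear relatively_open_manifold).
rewrite (tangent_linear_sum GL U0); apply: eq_bigr => i _.
set c := \sum_l W i l * 'D_(edge_vector i l) G W.
transitivity (\sum_j (U i j * 'D_(edge_vector i j) G W) - c * \sum_j U i j).
  rewrite mulr_sumr -sumrB; apply: eq_bigr => j _.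
  by rewrite mxE -/c mulrAC [W i j * _]mulrC mulfK ?lt0r_neq0// mulrBl [U i j * _]mulrC.
by rewrite ((tangent_spaceP U).1 U0) mulr0 subr0.
Qed.

(** [xget] picks some element of the defining set: the explicit gradient shows that one exists,
    nondegeneracy that it is the only one. *)
Lemma riemannian_gradientE G W : smooth_on manifold T0 G -> manifold W ->
  riemannian_gradient G W = explicit_gradient G W.
Proof.
move=> sG WM; rewrite /riemannian_gradient.
have gradP : [set X : mat | T0 X /\
    forall U, T0 U -> fisher_rao W X U = 'D_U G W] (explicit_gradient G W).
  split; first exact: tangent_space_explicit_gradient.
  by move=> U U0; exact: fisher_rao_explicit_gradient.
have [X0 XE] := xgetPex 0 (ex_intro _ _ gradP).
apply: fisher_rao_inj WM X0 gradP.1 _ => U U0.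
by rewrite XE// gradP.2.
Qed.

(** * Smoothness of the potential and of matrix pairs *)

Lemma smooth_on_id_entry i j : smooth_on manifold T0 (fun W : mat => W i j).
Proof.
apply: (smooth_on_entry relatively_open_manifold (f := idfun)).
apply: (smooth_on_linear relatively_open_manifold) => x; exact: cvg_id.
Qed.

Lemma smooth_on_potential F :
  smooth_on manifold T0 F -> smooth_on manifold T0 (@potential R m n F).
Proof.
move=> sF; have oM : relatively_open manifold T0 := relatively_open_manifold.
have sFij i j := smooth_on_entry oM i j sF.
have sWF (g : mat -> 'I_m.+1 -> 'I_n.+1 -> R) k :
    (forall j, smooth_on manifold T0 (fun W => g W k j)) ->
    smooth_on manifold T0 (fun W : mat => \sum_j W k j * g W k j).
  move=> sg; apply: (smooth_on_sum oM) => j.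
  by apply: (smooth_onM oM) => //; exact: smooth_on_id_entry.
apply: (smooth_on_eq_in oM (f := fun W : mat => - 2^-1 * \sum_k
    ((\sum_j W k j * (F W k j * F W k j))
     - (\sum_j W k j * F W k j) * (\sum_j W k j * F W k j)))).
  move=> W _; congr (_ * _); apply: eq_bigr => k _.
  rewrite /weighted_variance -expr2; congr (_ - _ ^+ 2).
    by apply: eq_bigr => j _; rewrite !mxE expr2.
  by apply: eq_bigr => j _; rewrite !mxE.
apply: (smooth_onMl oM); apply: (smooth_on_sum oM) => k; apply: (smooth_onB oM).
  by apply: (sWF (fun W k j => F W k j * F W k j)) => j; exact: (smooth_onM oM).
by apply: (smooth_onM oM); apply: (sWF F).
Qed.

Lemma continuous_fst_mx : continuous (fst : mat * mat -> mat).
Proof. move=> x; exact: cvg_fst. Qed.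

Lemma continuous_snd_mx : continuous (snd : mat * mat -> mat).
Proof. move=> x; exact: cvg_snd. Qed.

Lemma fisher_rao_variation0 (W U V : mat) : fisher_rao_variation W 0 U V = 0.
Proof.
by rewrite /fisher_rao_variation big1// => i _; rewrite big1// => j _;
  rewrite mxE mulr0 mul0r.
Qed.

Lemma fisher_rao0 (W U : mat) : fisher_rao W 0 U = 0.
Proof.
by rewrite /fisher_rao big1// => i _; rewrite big1// => j _; rewrite mxE !mul0r.
Qed.

(** On writing f as a finite combination of fixed basis pairs with its entries as coefficients, the
    closure properties apply. *)
Lemma smooth_on_matrix_pair {X : normedModType R} (D T : set X)
    (f : X -> mat * mat) : relatively_open D T ->
  (forall i j, smooth_on D T (fun x => (f x).1 i j)) ->
  (forall i j, smooth_on D T (fun x => (f x).2 i j)) -> smooth_on D T f.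
Proof.
move=> oD s1 s2.
apply: (smooth_on_eq_in oD (f := fun x : X =>
    \sum_i \sum_j (f x).1 i j *: ((delta_mx i j, 0) : mat * mat)
    + \sum_i \sum_j (f x).2 i j *: ((0, delta_mx i j) : mat * mat))).
  have E (A B : mat) : \sum_i \sum_j A i j *: ((delta_mx i j, 0) : mat * mat)
      + \sum_i \sum_j B i j *: ((0, delta_mx i j) : mat * mat) = (A, B).
    have sum1 (I : finType) (g : I -> mat * mat) : (\sum_i g i).1 = \sum_i (g i).1.
      exact: raddf_sum.
    have sum2 (I : finType) (g : I -> mat * mat) : (\sum_i g i).2 = \sum_i (g i).2.
      exact: raddf_sum.
    apply/pair_equal_spec; split.
      rewrite [LHS]/= !sum1 [X in _ + X]big1 => [|i _]; last first.
        by rewrite sum1 big1// => j _; rewrite /= scaler0.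
      rewrite addr0 [RHS]matrix_sum_delta; apply: eq_bigr => i _; exact: sum1.
    rewrite [LHS]/= !sum2 [X in X + _]big1 => [|i _]; last first.
      by rewrite sum2 big1// => j _; rewrite /= scaler0.
    rewrite add0r [RHS]matrix_sum_delta; apply: eq_bigr => i _; exact: sum2.
  by move=> x _; rewrite E; case: (f x).
by apply: (smooth_onD oD); apply: (smooth_on_sum oD) => i;
  apply: (smooth_on_sum oD) => j; apply: (smooth_on_scalel oD).
Qed.

(** * Energy and Lagrangian two-form *)

Section Lagrangian.
Context (F : mat -> mat).
Hypothesis sF : smooth_on manifold T0 F.
Notation G := (potential F).
Notation L := (lagrangian F).

Lemma manifold_neq0 (W : mat) i j : manifold W -> W i j != 0.
Proof. by move=> /assignment_manifoldP[W0 _]; rewrite lt0r_neq0. Qed.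

(** With W fixed, the variation term and the potential drop out, and symmetry of the metric gives
    two equal terms that absorb the factor 1/2. *)
Lemma fiber_derivativeE (x : mat * mat) (Z : mat) : TW x ->
  (fiber_derivative L x).2 Z = fisher_rao x.1 x.2 Z.
Proof.
case: x => W V [/= WM V0].
have FRE := is_derive_fisher_rao (fun i j => manifold_neq0 i j WM)
  (is_derive_cst W V Z) (is_derive_id V Z) (is_derive_id V Z).
have [_ ->] := is_deriveB (is_deriveZ (2^-1) FRE) (is_derive_cst (G W) V Z).
rewrite fisher_rao_variation0 !subr0 (fisher_raoC W Z V).
have E (a : R) : 2^-1 * (a + a) = a by field.
exact: E.
Qed.

Lemma energyE (x : mat * mat) : TW x ->
  energy L x = 2^-1 * fisher_rao x.1 x.2 x.2 + G x.1.
Proof.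
by move=> xT; rewrite /energy fiber_derivativeE// /lagrangian; field.
Qed.

Lemma is_derive_fst (x u : mat * mat) : is_derive x u fst u.1.
Proof. exact: (is_derive_linear (f := fst)) continuous_fst_mx. Qed.

Lemma is_derive_snd (x u : mat * mat) : is_derive x u snd u.2.
Proof. exact: (is_derive_linear (f := snd)) continuous_snd_mx. Qed.

Lemma derive_energy (x u : mat * mat) : TW x -> TTW u ->
  'D_u (energy L) x = fisher_rao x.1 x.2 u.2
    - 2^-1 * fisher_rao_variation x.1 u.1 x.2 x.2 + 'D_(u.1) G x.1.
Proof.
move=> xT uT; have [xM x0] := xT; have [u10 u20] := uT.
have FRE := is_derive_fisher_rao (fun i j => manifold_neq0 i j xM)
  (is_derive_fst x u) (is_derive_snd x u) (is_derive_snd x u).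
have GE : is_derive x u (G \o fst) ('D_(u.1) G x.1).
  have [dG _] := smooth_on_is_derive (smooth_on_potential sF) xM u10.
  split; first exact: (derivable_comp_linear (f := fst)).
  exact: (congr1 (fun h => h x) (derive_comp_linear fst G u)).
have E := is_deriveD (is_deriveZ (2^-1) FRE) GE.
(* The closed form of the energy is known on the bundle only; its derivative transfers because u is
   tangent to the bundle. *)
have [_ ->] := is_derive_eq_in relatively_open_bundle
  (fun y yT => esym (energyE (set_mem yT))) xT uT E.
rewrite (fisher_raoC x.1 u.2); congr (_ + _).
by rewrite /GRing.scale /=; field.
Qed.

Lemma cotangent_differential1 (x u : mat * mat) :
  (cotangent_differential (fiber_derivative L) x u).1 = u.1.
Proof. by have [_ E] := is_derive_fst x u; exact: E. Qed.

Lemma cotangent_differential2 (x u : mat * mat) (Z : mat) : TW x -> TTW u ->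
  (cotangent_differential (fiber_derivative L) x u).2 Z =
  fisher_rao x.1 u.2 Z - fisher_rao_variation x.1 u.1 x.2 Z.
Proof.
move=> xT uT; have [xM _] := xT.
have FRE := is_derive_fisher_rao (fun i j => manifold_neq0 i j xM)
  (is_derive_fst x u) (is_derive_snd x u) (is_derive_cst Z x u).
have [_ E] := is_derive_eq_in relatively_open_bundle
  (fun y yT => esym (fiber_derivativeE Z (set_mem yT))) xT uT FRE.
rewrite [LHS]E.
by rewrite (fisher_raoC _ _ 0) fisher_rao0 addr0.
Qed.

Lemma lagrangian_formE (x u w : mat * mat) : TW x -> TTW u -> TTW w ->
  lagrangian_form L x u w = fisher_rao x.1 w.2 u.1 - fisher_rao x.1 u.2 w.1.
Proof.
move=> xT uT wT; have [u10 _] := uT; have [w10 _] := wT.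
have lin y : TTW y ->
    tangent_linear (cotangent_differential (fiber_derivative L) x y).2.
  move=> yT a U V _ _; rewrite !cotangent_differential2//.
  rewrite (fisher_raoC _ y.2 (_ + _)) fisher_raoP fisher_rao_variationP.
  rewrite !(fisher_raoC _ _ y.2); ring.
have T0u y : TTW y -> T0 (cotangent_differential (fiber_derivative L) x y).1.
  by move=> [y10 _]; rewrite cotangent_differential1.
have pairing y z : TTW y ->
    (cotangent_differential (fiber_derivative L) x y).2
      (cotangent_differential (fiber_derivative L) x z).1 =
    fisher_rao x.1 y.2 z.1 - fisher_rao_variation x.1 y.1 x.2 z.1.
  move=> yT; rewrite [(cotangent_differential _ _ z).1]cotangent_differential1.
  exact: cotangent_differential2.
apply: (etrans (canonical_formE (T0u _ uT) (T0u _ wT) (lin _ uT) (lin _ wT))).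
apply: (etrans (congr2 (fun a b => a - b) (pairing _ u wT) (pairing _ w uT))).
(* Exchanging the outer two arguments identifies the variation terms of u and w, which then
   cancel. *)
rewrite (fisher_rao_variationC _ w.1); ring.
Qed.

(** The gradient is defined by choice, so smoothness is read off the explicit formula, whose entries
    are rational in those of W and V and the edge derivatives of G. *)
Lemma smooth_on_lagrangian_field :
  smooth_on TW TTW (fun x : mat * mat =>
    (x.2, 2^-1 *: quadratic_map x.1 x.2 - riemannian_gradient G x.1)).
Proof.
have oM : relatively_open manifold T0 := relatively_open_manifold.
have oT : relatively_open TW TTW := relatively_open_bundle.
have sG := smooth_on_potential sF.
have s1 (g : mat -> R) : smooth_on manifold T0 g -> smooth_on TW TTW (fun x => g x.1).
  apply: (smooth_on_comp_linear (f := fst)); first exact: continuous_fst_mx.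
    by move=> x [].
  by move=> x [].
have sW i j : smooth_on TW TTW (fun x : mat * mat => x.1 i j).
  exact: s1 (smooth_on_id_entry i j).
have sV i j : smooth_on TW TTW (fun x : mat * mat => x.2 i j).
  apply: (smooth_on_entry oT).
  exact: (smooth_on_linear oT (f := snd)) continuous_snd_mx.
have sVW i j : smooth_on TW TTW (fun x : mat * mat => (x.1 i j)^-1).
  by apply: (smooth_onV oT) => // x [xM _]; exact: manifold_neq0.
have sD i j : smooth_on manifold T0 (fun W => 'D_(edge_vector i j) G W).
  by apply: smooth_on_derive => //; exact: tangent_space_edge.
apply: (smooth_on_matrix_pair oT) => i j //=.
have sVVW k l : smooth_on TW TTW (fun x : mat * mat => x.2 k l * x.2 k l * (x.1 k l)^-1).
  by apply: (smooth_onM oT) => //; exact: (smooth_onM oT).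
have sA : smooth_on TW TTW (fun x : mat * mat => x.2 i j * x.2 i j * (x.1 i j)^-1
    - (\sum_l x.2 i l * x.2 i l * (x.1 i l)^-1) * x.1 i j).
  apply: (smooth_onB oT) => //; apply: (smooth_onM oT) => //.
  exact: (smooth_on_sum oT).
have sgrad : smooth_on manifold T0 (fun W => explicit_gradient G W i j).
  apply: (smooth_on_eq_in oM (f := fun W => W i j * ('D_(edge_vector i j) G W
    - \sum_l W i l * 'D_(edge_vector i l) G W))); first by move=> W _; rewrite mxE.
  apply: (smooth_onM oM); first exact: smooth_on_id_entry.
  apply: (smooth_onB oM) => //; apply: (smooth_on_sum oM) => l.
  by apply: (smooth_onM oM) => //; exact: smooth_on_id_entry.
have sX : smooth_on TW TTW (fun x : mat * mat => 2^-1 * (x.2 i j * x.2 i j * (x.1 i j)^-1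
    - (\sum_l x.2 i l * x.2 i l * (x.1 i l)^-1) * x.1 i j) - explicit_gradient G x.1 i j).
  apply: (smooth_onB oT); first exact: (smooth_onMl oT).
  exact: (s1 (fun W => explicit_gradient G W i j)).
apply: (smooth_on_eq_in oT) sX.
move=> x /set_mem [xM _]; rewrite (riemannian_gradientE sG xM) !mxE.
congr (_ * (_ - _ * _) - _).
by apply: eq_bigr => l _; rewrite !mxE expr2.
Qed.

End Lagrangian.

End AssignmentManifold.

(** * Characterisation of the Lagrangian vector field on the bundle *)

Theorem proposition4p8 (R : realType) (m n : nat)
    (F : 'M[R]_(m.+1, n.+1) -> 'M[R]_(m.+1, n.+1))
    (hF : smooth_on (assignment_manifold R m n) (tangent_space R m n) F)
    (X : 'M[R]_(m.+1, n.+1) * 'M[R]_(m.+1, n.+1) ->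
         'M[R]_(m.+1, n.+1) * 'M[R]_(m.+1, n.+1)) :
  is_lagrangian_vector_field (lagrangian F) X <->
  forall W V : 'M[R]_(m.+1, n.+1),
    assignment_manifold R m n W -> tangent_space R m n V ->
    X (W, V) = (V, 2^-1 *: quadratic_map W V -
                   riemannian_gradient (potential F) W).
Proof.
set T0 := tangent_space R m n.
have sG := smooth_on_potential hF.
have Zin W V : assignment_manifold R m n W ->
    T0 (2^-1 *: quadratic_map W V - riemannian_gradient (potential F) W).
  move=> WM; rewrite (riemannian_gradientE sG WM) addrC -scaleN1r.
  apply: tangent_space_linear; first exact: tangent_space_explicit_gradient.
  rewrite -[_ *: _]addr0; apply: tangent_space_linear tangent_space0.
  exact: tangent_space_quadratic_map.
have ZE W V U : assignment_manifold R m n W -> T0 U ->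
    fisher_rao W (2^-1 *: quadratic_map W V - riemannian_gradient (potential F) W) U
    = 2^-1 * fisher_rao_variation W U V V - 'D_U (potential F) W.
  move=> WM U0; rewrite (riemannian_gradientE sG WM) fisher_raoP.
  rewrite -scaleN1r -[_ *: explicit_gradient _ _]addr0 fisher_raoP fisher_rao0 addr0.
  by rewrite fisher_rao_quadratic_map// fisher_rao_explicit_gradient// mulN1r.
split=> [[[XT _] XE] W V WM V0|XE].
  have xT : tangent_bundle R m n (W, V) by [].
  have [Y10 Y20] := XT _ xT.
  rewrite [X (W, V)]surjective_pairing; congr pair.
    (* Vertical test vectors (0, U) leave g_W(V, U) = g_W(U, X1), which determines the first
       component. *)
    apply: (fisher_rao_inj WM) => // U U0.
    have uT : double_tangent_space R m n (0, U) by split=> //; exact: tangent_space0.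
    have := XE _ xT _ uT.
    rewrite (derive_energy hF xT uT) (lagrangian_formE F xT (XT _ xT) uT).
    rewrite /= derive0 (fisher_raoC _ _ 0) fisher_rao0.
    rewrite fisher_rao_variation0 mulr0 !subr0 addr0 => ->.
    by rewrite fisher_raoC.
  (* Test vectors (U, 0) remove X1 from the equation and determine g_W(X2, U). *)
  apply: (fisher_rao_inj WM) => //; first exact: Zin.
  move=> U U0; rewrite ZE//.
  have uT : double_tangent_space R m n (U, 0) by split=> //; exact: tangent_space0.
  have := XE _ xT _ uT.
  rewrite (derive_energy hF xT uT) (lagrangian_formE F xT (XT _ xT) uT).
  rewrite /= (fisher_raoC W V) !fisher_rao0 !sub0r => /eqP.
  by rewrite -eqr_opp opprD !opprK => /eqP <-.
have XZ x : tangent_bundle R m n x -> X x =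
    (x.2, 2^-1 *: quadratic_map x.1 x.2 - riemannian_gradient (potential F) x.1).
  by case: x => W V [/= WM V0]; exact: XE.
have XT x : tangent_bundle R m n x -> double_tangent_space R m n (X x).
  by move=> xT; rewrite XZ//; case: xT => xM x0; split=> //; exact: Zin.
split=> [|x xT u uT]; first split=> //.
  (* X is prescribed on the bundle only, so it inherits smoothness from the formula through
     agreement there. *)
  apply: (smooth_on_eq_in relatively_open_bundle) (smooth_on_lagrangian_field hF).
  by move=> x /set_mem /XZ.
have [xM x0] := xT; have [u10 _] := uT.
rewrite (derive_energy hF xT uT) (lagrangian_formE F xT (XT _ xT) uT).
rewrite XZ// ZE//= [fisher_rao x.1 u.2 _]fisher_raoC.
by rewrite opprB addrCA [LHS]addrC.
Qed.
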